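(* Let $\mathcal E\in\mathbb R^{n^{\times d}}_{ps,+}$. Then $$\rho_{\mathrm{trop}}(\mathcal E)\le\rho(\mathcal E)\le n^{d-1}\rho_{\mathrm{trop}}(\mathcal E).$$
   Context: Let $n\ge1$, $d\ge3$ be integers, $[n]=\{1,\dots,n\}$. $\mathbb R^{n^{\times d}}_{ps,+}$ is the set of tensors $\mathcal E=[e_{i_1,\dots,i_d}]$, $i_1,\dots,i_d\in[n]$, with nonnegative real entries symmetric in the last $d-1$ indices. For $x\in\mathbb C^n$, $\mathcal E(x)_i=\sum_{i_2,\dots,i_d\in[n]}e_{i,i_2,\dots,i_d}x_{i_2}\cdots x_{i_d}$, and $x^{\circ p}=(x_1^p,\dots,x_n^p)^\top$. An eigenvalue of $\mathcal E$ is $\lambda\in\mathbb C$ with $\mathcal E(x)=\lambda x^{\circ(d-1)}$ for some nonzero $x\in\mathbb C^n$; $\rho(\mathcal E)$ is the maximum modulus of the eigenvalues. A nonzero nonnegative vector $u\in\mathbb R^n$ is a tropical eigenvector of $\mathcal E$ with tropical eigenvalue $\lambda$ if $\max_{i_2,\dots,i_d\in[n]}e_{i,i_2,\dots,i_d}u_{i_2}\cdots u_{i_d}=\lambda u_i^{d-1}$ for all $i\in[n]$. Tropical eigenvalues exist and are finite in number; $\rho_{\mathrm{trop}}(\mathcal E)$ is the largest one. *)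

(* Defs.v *)
From HB Require Import structures.
From mathcomp Require Import all_boot all_order all_algebra all_fingroup.
From mathcomp Require Import boolp classical_sets reals.
From mathcomp.real_closed Require Import complex.

Set Implicit Arguments.
Unset Strict Implicit.
Unset Printing Implicit Defensive.

Import Order.TTheory GRing.Theory Num.Theory.

Local Open Scope classical_set_scope.
Local Open Scope complex_scope.
Local Open Scope ring_scope.

Section Maximum.
Variable R : realType.
Implicit Types A : set R.

Definition is_maximum A : set R := A `&` ubound A.

(* The value 0 is used only when A has no greatest element. *)
Definition maximum A : R := xget 0 (is_maximum A).

Lemma maximumE A m : is_maximum A m -> maximum A = m.
Proof.
move=> Am; apply: xget_unique => // p Ap.
by apply/eqP; rewrite eq_le (Am.2 _ Ap.1) (Ap.2 _ Am.1).
Qed.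

End Maximum.

Section Tensors.
Variables (R : realType) (n d : nat).

(* The d.-1 indices after the first are gathered in a multi-index J, so that
   E i J is the entry e_{i, J 0, ..., J (d - 2)}. *)
Definition multi_index := {ffun 'I_d.-1 -> 'I_n}.

Definition tensor := 'I_n -> multi_index -> R.

Implicit Types (E : tensor) (i : 'I_n) (J : multi_index).

Definition partially_symmetric E :=
  forall i J (s : 'S_d.-1), E i [ffun k => J (s k)] = E i J.

Definition nonnegative E := forall i J, 0 <= E i J.

Definition tensor_map E (x : 'cV[R[i]]_n) : 'cV[R[i]]_n :=
  \col_i \sum_(J : multi_index) (E i J)%:C * \prod_(k < d.-1) x (J k) 0.

Definition hadamard_power (p : nat) (x : 'cV[R[i]]_n) : 'cV[R[i]]_n :=
  \col_i x i 0 ^+ p.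

Definition tensor_eigenvalue E (lambda : R[i]) :=
  exists2 x : 'cV[R[i]]_n, x != 0 &
    tensor_map E x = lambda *: hadamard_power d.-1 x.

(* Normc.normc is the modulus with values in R; `|_| would land in R[i]. *)
Definition spectral_radius E : R :=
  maximum [set Normc.normc lambda | lambda in [set l | tensor_eigenvalue E l]].

(* Taking 0 as the value of the empty maximum is harmless when E and u are
   nonnegative, since then all the terms are nonnegative. *)
Definition trop_map E (u : 'cV[R]_n) : 'cV[R]_n :=
  \col_i \big[Order.max/0]_(J : multi_index)
    (E i J * \prod_(k < d.-1) u (J k) 0).

Definition trop_eigenpair E (lambda : R) (u : 'cV[R]_n) :=
  [/\ u != 0, forall i, 0 <= u i 0 &
    forall i, trop_map E u i 0 = lambda * u i 0 ^+ d.-1].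

Definition trop_eigenvalue E (lambda : R) :=
  exists u : 'cV[R]_n, trop_eigenpair E lambda u.

Definition trop_spectral_radius E : R :=
  maximum [set lambda | trop_eigenvalue E lambda].

End Tensors.

(* Main.v *)
(** A continuous isotone map F on the nonnegative orthant, homogeneous of degree
    m, has a nonnegative eigenvector, F x = mu x^m, whose eigenvalue mu is the
    largest number nu with nu y^m <= F y for some nonzero y >= 0.  If F is
    strictly isotone, a maximal such nu is attained by compactness of the
    simplex, and maximality forces equality; in general one perturbs F by
    e (sum_j x_j^m) and lets e tend to 0.  This applies both to the polynomial
    map of E, where taking moduli shows that mu is the spectral radius, and to
    its tropical map, where mu is the tropical spectral radius.  The two bounds
    then follow from max <= sum <= n^(d-1) max, since this turns an inequality
    nu y^m <= F y for one map into such an inequality for the other. *)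

Require Import Defs.
From mathcomp Require Import all_boot all_order all_algebra.
From mathcomp Require Import lra boolp classical_sets reals.
From mathcomp Require Import topology normedtype derive realfun exp.
From mathcomp.real_closed Require Import complex.

Import Order.TTheory GRing.Theory Num.Theory.
Import numFieldNormedType.Exports.

Set Implicit Arguments.
Unset Strict Implicit.
Unset Printing Implicit Defensive.

Local Open Scope classical_set_scope.
Local Open Scope ring_scope.

(** * Continuity of finite sums, products and maxima *)

Section ContinuousBig.
Variables (R : realType) (T : topologicalType).

Lemma continuous_big (op : R -> R -> R) (x0 : R) (I : Type) (r : seq I)
    (P : pred I) (F : I -> T -> R) :
  continuous (fun p : R * R => op p.1 p.2) ->
  (forall i, P i -> continuous (F i)) ->
  continuous (fun x => \big[op/x0]_(i <- r | P i) F i x).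
Proof.
move=> op_cont F_cont x.
by apply: (@cvg_big R I op x0 P op_cont T (nbhs x)) => i Pi; exact: F_cont.
Qed.

Lemma continuous_sum (I : Type) (r : seq I) (F : I -> T -> R) :
  (forall i, continuous (F i)) ->
  continuous (fun x => \sum_(i <- r) F i x).
Proof.
move=> F_cont; apply: continuous_big => [|i _]; last exact: F_cont.
exact: (@add_continuous R^o).
Qed.

Lemma continuous_add (f g : T -> R) :
  continuous f -> continuous g -> continuous (fun x => f x + g x).
Proof. by move=> f_cont g_cont x; apply: cvgD; [exact: f_cont|exact: g_cont]. Qed.

Lemma continuous_mul (f g : T -> R) :
  continuous f -> continuous g -> continuous (fun x => f x * g x).
Proof. by move=> f_cont g_cont x; apply: cvgM; [exact: f_cont|exact: g_cont]. Qed.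

Lemma continuous_exprn (f : T -> R) k :
  continuous f -> continuous (fun x => f x ^+ k).
Proof.
move=> f_cont x.
exact: (continuous_comp (f_cont x) (@exprn_continuous R k (f x))).
Qed.

End ContinuousBig.

(** * Nonlinear Perron-Frobenius theory on the nonnegative orthant *)

Section PerronFrobenius.
Variables (R : realType) (n m : nat).
Hypothesis m_gt0 : (0 < m)%N.

Definition ge0_vec (x : 'rV[R]_n.+1) := forall i, 0 <= x 0 i.

(** Only factors c >= 0 are allowed: for c < 0 and m odd, c^m would turn the maxima of the tropical
    map into minima. *)
Definition homogeneous (F : 'rV[R]_n.+1 -> 'I_n.+1 -> R) :=
  forall c (x : 'rV[R]_n.+1) i, 0 <= c -> F (c *: x) i = c ^+ m * F x i.

Definition isotone (F : 'rV[R]_n.+1 -> 'I_n.+1 -> R) :=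
  forall x y : 'rV[R]_n.+1, ge0_vec x -> (forall i, x 0 i <= y 0 i) ->
  forall i, F x i <= F y i.

(** Raising one coordinate of x raises every coordinate of F x: the nonlinear counterpart of a
    matrix with positive entries. *)
Definition strictly_isotone (F : 'rV[R]_n.+1 -> 'I_n.+1 -> R) :=
  forall x y : 'rV[R]_n.+1, ge0_vec x -> (forall i, x 0 i <= y 0 i) -> x != y ->
  forall i, F x i < F y i.

(** The largest such mu is the Collatz-Wielandt number of F. For continuous F the inequality is a
    closed condition, and it passes from a map to any larger one. *)
Definition subeigenpair (F : 'rV[R]_n.+1 -> 'I_n.+1 -> R) (mu : R)
    (x : 'rV[R]_n.+1) :=
  [/\ x != 0, ge0_vec x & forall i, mu * x 0 i ^+ m <= F x i].

Definition simplex : set 'rV[R]_n.+1 :=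
  [set x | ge0_vec x /\ \sum_i x 0 i = 1].

Lemma sum_vec_gt0 (x : 'rV[R]_n.+1) :
  x != 0 -> ge0_vec x -> 0 < \sum_i x 0 i.
Proof.
move=> x_neq0 x_ge0; rewrite lt_neqAle sumr_ge0 ?andbT //.
apply: contra x_neq0; rewrite eq_sym psumr_eq0 // => /allP x0.
by apply/eqP/rowP => i; rewrite mxE; apply/eqP/x0; rewrite mem_index_enum.
Qed.

Lemma simplex_neq0 x : simplex x -> x != 0.
Proof.
move=> [_ sx]; apply/eqP => x0; move: sx.
by rewrite x0 big1 => [/eqP|i _]; rewrite ?mxE // eq_sym oner_eq0.
Qed.

Lemma simplex_le1 x i : simplex x -> x 0 i <= 1.
Proof.
move=> [x_ge0 <-]; rewrite (bigD1 i) //= lerDl.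
by apply: sumr_ge0 => j _; exact: x_ge0.
Qed.

Lemma simplex_nonempty : simplex !=set0.
Proof.
exists (delta_mx 0 0); split=> [i|]; first by rewrite mxE ler0n.
rewrite (bigD1 0) //= big1 ?mxE ?eqxx ?addr0 // => i /negPf i0.
by rewrite mxE i0 andbF.
Qed.

(** A closed subset of the compact cube [0, 1]^(n+1). *)
Lemma compact_simplex : compact simplex.
Proof.
apply: (@subclosed_compact _ simplex
    [set v : 'rV[R]_n.+1 | forall i, `[0, 1]%classic (v ord0 i)]).
- have -> : simplex = (\bigcap_(i in [set: 'I_n.+1])
      (fun x : 'rV[R]_n.+1 => x 0 i) @^-1` [set t | 0 <= t]) `&`
      (fun x : 'rV[R]_n.+1 => \sum_i x 0 i) @^-1` [set 1].
    apply/seteqP; split=> x [x_ge0 sx]; split=> // i; last exact: x_ge0.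
    by move=> _; exact: x_ge0.
  apply: closedI.
    apply: closed_bigI => i _; apply: preimage_closed; last exact: closed_ge.
    by move=> x _; exact: coord_continuous.
  apply: preimage_closed; last exact: closed_eq.
  by move=> x _; apply: continuous_sum => i; exact: coord_continuous.
- apply: (@rV_compact R _ (fun=> `[0, 1]%classic)) => _.
  exact: segment_compact.
- move=> x sx i; rewrite /= in_itv /= simplex_le1 // andbT.
  by case: sx => + _; apply.
Qed.

(** * Maximal subeigenpairs by compactness *)

Section Map.
Variable F : 'rV[R]_n.+1 -> 'I_n.+1 -> R.
Hypotheses (F_hom : homogeneous F) (F_iso : isotone F).

Lemma isotone_ge0 x i : ge0_vec x -> 0 <= F x i.
Proof.
(* Homogeneity with c = 0, where c^m vanishes because m > 0. *)
move=> x_ge0; have F0 : F 0 i = 0.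
  by rewrite -(scale0r (0 : 'rV_n.+1)) F_hom // expr0n gtn_eqF ?mul0r.
by rewrite -F0; apply: F_iso => j; rewrite mxE.
Qed.

Lemma subeigenpair_scale mu (x : 'rV[R]_n.+1) (c : R) :
  0 < c -> subeigenpair F mu x -> subeigenpair F mu (c *: x).
Proof.
move=> c_gt0 [x_neq0 x_ge0 Fx]; split=> [|i|i].
- by rewrite scaler_eq0 negb_or gt_eqF.
- by rewrite mxE mulr_ge0 // ltW.
- by rewrite mxE F_hom ?(ltW c_gt0) // exprMn mulrCA ler_pM2l // exprn_gt0.
Qed.

Lemma subeigenpair_simplex mu x : subeigenpair F mu x ->
  exists2 y, simplex y & subeigenpair F mu y.
Proof.
move=> Fx; case: (Fx) => x_neq0 x_ge0 _.
have s_gt0 := sum_vec_gt0 x_neq0 x_ge0.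
exists ((\sum_i x 0 i)^-1 *: x); last first.
  by apply: subeigenpair_scale => //; rewrite invr_gt0.
split=> [i|]; first by rewrite mxE mulr_ge0 // invr_ge0 ltW.
under eq_bigr do rewrite mxE.
by rewrite -mulr_sumr mulVf // gt_eqF.
Qed.

(* At the index where x is largest, F x i <= (x i)^m F(1, ..., 1) i. *)
Lemma subeigenpair_le mu x :
  subeigenpair F mu x -> mu <= \sum_i F (const_mx 1) i.
Proof.
move=> [x_neq0 x_ge0 Fx].
pose i := [arg max_(j > 0) x 0 j]%O.
have x_max j : x 0 j <= x 0 i by rewrite /i; case: arg_maxP => // k _; apply.
have xi_gt0 : 0 < x 0 i.
  rewrite lt_neqAle x_ge0 andbT; apply: contra x_neq0 => /eqP xi0.
  apply/eqP/rowP => j; rewrite mxE; apply/eqP.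
  by rewrite eq_le x_ge0 xi0 x_max.
have one_ge0 : ge0_vec (const_mx 1) by move=> j; rewrite mxE ler01.
have /(le_trans (Fx i)) : F x i <= F (x 0 i *: const_mx 1) i.
  by apply: F_iso => // j; rewrite !mxE mulr1.
rewrite F_hom // mulrC ler_pM2l ?exprn_gt0 // => /le_trans; apply.
by rewrite (bigD1 i) //= lerDl sumr_ge0 // => j _; exact: isotone_ge0.
Qed.

Hypothesis F_cont : forall i, continuous (F ^~ i).

Lemma residual_continuous i : continuous
  (fun p : 'rV[R]_n.+1 * R => F p.1 i - p.2 * p.1 0 i ^+ m).
Proof.
have fst_cont : continuous (fst : 'rV[R]_n.+1 * R -> 'rV[R]_n.+1).
  by move=> q; exact: cvg_fst.
have pow_cont : continuous (fun q : 'rV[R]_n.+1 * R => q.1 0 i ^+ m).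
  apply: continuous_exprn => q.
  exact: (continuous_comp (fst_cont q) (@coord_continuous _ _ _ 0 i q.1)).
move=> p; apply: cvgB.
  exact: (continuous_comp (fst_cont p) (F_cont (x := p.1))).
by apply: cvgM; [exact: cvg_snd|exact: pow_cont].
Qed.

(** The second projection attains its maximum on a compact set of pairs (x, mu): normalization
    bounds x and [subeigenpair_le] bounds mu. *)
Lemma max_subeigenpair : exists mu x,
  [/\ 0 <= mu, simplex x, subeigenpair F mu x
    & forall nu y, subeigenpair F nu y -> nu <= mu].
Proof.
pose M := \sum_i F (const_mx 1) i.
pose box := simplex `*` `[0, M]%classic.
pose A := box `&` \bigcap_(i in [set: 'I_n.+1])
   (fun p : 'rV[R]_n.+1 * R => F p.1 i - p.2 * p.1 0 i ^+ m) @^-1`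
     [set t | 0 <= t].
have M_ge0 : 0 <= M.
  apply: sumr_ge0 => i _; apply: isotone_ge0 => j.
  by rewrite mxE ler01.
have A_compact : compact A.
  apply: compact_closedI.
    by apply: compact_setX; [exact: compact_simplex|exact: segment_compact].
  apply: closed_bigI => i _; apply: preimage_closed; last exact: closed_ge.
  by move=> p _; exact: residual_continuous.
have in_A mu x : 0 <= mu -> simplex x -> subeigenpair F mu x -> A (x, mu).
  move=> mu_ge0 sx Fx; split; last by case: Fx => _ _ Fx i _ /=; rewrite subr_ge0.
  by split=> //=; rewrite in_itv /= mu_ge0 (subeigenpair_le Fx).
have [x0 sx0] := simplex_nonempty.
have A_neq0 : A !=set0.
  exists (x0, 0); apply: in_A => //; split=> [||i].
  - exact: simplex_neq0.
  - by case: sx0.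
  - by rewrite mul0r isotone_ge0 //; case: sx0.
have snd_cont : {within A, continuous (snd : 'rV[R]_n.+1 * R -> R)}.
  by apply: continuous_subspaceT => q; exact: cvg_snd.
have [[x mu] xmuA mu_max] := compact_EVT_max A_neq0 A_compact snd_cont.
have [[sx /=]] := set_mem xmuA; rewrite in_itv /= => /andP[mu_ge0 _] Fx.
exists mu, x; split=> //.
  split=> [||i]; [exact: simplex_neq0|by case: sx|].
  by have := Fx i I; rewrite /= subr_ge0.
(* A nonpositive nu may fall outside [box], but it is at most mu since mu >= 0. *)
move=> nu y Fy; have [nu_le0|/ltW nu_ge0] := leP nu 0.
  exact: le_trans nu_le0 mu_ge0.
have [z sz Fz] := subeigenpair_simplex Fy.
by apply: (mu_max (z, nu)); apply/mem_set/in_A.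
Qed.

End Map.

(** * Maximal subeigenpairs of strictly isotone maps *)

Definition nth_root (t : R) := t `^ m%:R^-1.

Lemma nth_root_ge0 t : 0 <= nth_root t.
Proof. exact: powR_ge0. Qed.

Lemma nth_rootK t : 0 <= t -> nth_root t ^+ m = t.
Proof.
move=> t_ge0; rewrite -powR_mulrn ?powR_ge0 // -powRrM mulVf ?powRr1 //.
by rewrite pnatr_eq0 -lt0n.
Qed.

(* If F x <> mu x^m, the vector y with y^m = F x dominates mu^(1/m) x, whence
   F y > mu y^m in every coordinate and mu could be increased. *)
Lemma max_subeigenpair_eigen F mu x :
  homogeneous F -> isotone F -> strictly_isotone F -> 0 <= mu ->
  subeigenpair F mu x -> (forall nu y, subeigenpair F nu y -> nu <= mu) ->
  forall i, F x i = mu * x 0 i ^+ m.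
Proof.
move=> F_hom F_iso F_strict mu_ge0 [x_neq0 x_ge0 Fx] mu_max.
have Fx_ge0 i : 0 <= F x i by exact: isotone_ge0.
pose y : 'rV[R]_n.+1 := \row_i nth_root (F x i).
have yE i : y 0 i ^+ m = F x i by rewrite mxE nth_rootK.
have y_ge0 : ge0_vec y by move=> i; rewrite mxE nth_root_ge0.
pose z := nth_root mu *: x.
have zE i : z 0 i ^+ m = mu * x 0 i ^+ m by rewrite mxE exprMn nth_rootK.
have z_ge0 : ge0_vec z by move=> i; rewrite mxE mulr_ge0 // nth_root_ge0.
have zy i : z 0 i <= y 0 i.
  by rewrite -(@ler_pXn2r _ m) ?nnegrE // zE yE.
have [zyE i|z_neq_y] := eqVneq z y; first by rewrite -yE -zyE zE.
have Fy i : mu * y 0 i ^+ m < F y i.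
  by rewrite yE -[mu]nth_rootK // -F_hom ?nth_root_ge0 // F_strict.
have y_neq0 : y != 0.
  apply: contra z_neq_y => /eqP y0; apply/eqP/rowP => i.
  by apply/eqP; rewrite eq_le zy y0 mxE z_ge0.
pose s := \sum_i y 0 i ^+ m.
have ym_ge0 i : 0 <= y 0 i ^+ m by rewrite exprn_ge0.
have s_ge0 : 0 <= s by exact: sumr_ge0.
pose i := [arg min_(j < 0) (F y j - mu * y 0 j ^+ m)]%O.
pose gap := F y i - mu * y 0 i ^+ m.
have gap_min j : gap <= F y j - mu * y 0 j ^+ m.
  by rewrite /gap /i; case: arg_minP => // k _; apply.
have gap_gt0 : 0 < gap by rewrite subr_gt0.
(* As y_j^m <= s, adding gap / (s + 1) to mu costs at most [gap] in each coordinate; the 1 keeps the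
   divisor positive. *)
have : mu + gap / (s + 1) <= mu.
  apply: (mu_max _ y); split=> // j.
  rewrite mulrDl -lerBrDl; apply: le_trans (gap_min j).
  rewrite -mulrA ler_piMr ?(ltW gap_gt0) // ler_pdivrMl ?ltr_wpDl // mulr1.
  by rewrite ler_wpDr // /s (bigD1 j) //= lerDl sumr_ge0.
by rewrite gerDl leNgt divr_gt0 // ltr_wpDl.
Qed.

(** * Perturbation and passage to the limit *)

Definition perturbation (F : 'rV[R]_n.+1 -> 'I_n.+1 -> R) (e : R)
    (x : 'rV[R]_n.+1) i :=
  F x i + e * \sum_j x 0 j ^+ m.

Lemma perturbation_homogeneous F e :
  homogeneous F -> homogeneous (perturbation F e).
Proof.
move=> F_hom c x i c_ge0; rewrite /perturbation F_hom // mulrDr; congr (_ + _).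
rewrite mulrCA; congr (_ * _); rewrite mulr_sumr.
by apply: eq_bigr => j _; rewrite mxE exprMn.
Qed.

Lemma perturbation_isotone F e :
  0 <= e -> isotone F -> isotone (perturbation F e).
Proof.
move=> e_ge0 F_iso x y x_ge0 xy i; apply: lerD; first exact: F_iso.
apply: ler_wpM2l => //; apply: ler_sum => j _.
by rewrite lerXn2r // nnegrE // (le_trans (x_ge0 j)).
Qed.

(** The added term increases strictly with each x_j and is shared by all coordinates of the map, so
    a single increase in x is felt everywhere. *)
Lemma perturbation_strictly_isotone F e :
  0 < e -> isotone F -> strictly_isotone (perturbation F e).
Proof.
move=> e_gt0 F_iso x y x_ge0 xy x_neq_y i.
apply: ler_ltD; first exact: F_iso.
rewrite ltr_pM2l //.
have y_ge0 j : 0 <= y 0 j by exact: le_trans (xy j).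
have [j xyj] : exists j, x 0 j != y 0 j.
  apply/existsP; apply: contraNT x_neq_y; rewrite negb_exists => /forallP xyE.
  by apply/eqP/rowP => j; apply/eqP; rewrite -[_ == _]negbK.
rewrite (bigD1 j) //= [ltRHS](bigD1 j) //=; apply: ltr_leD.
  by rewrite ltr_pXn2r ?nnegrE // lt_neqAle xyj xy.
by apply: ler_sum => k _; rewrite lerXn2r // nnegrE.
Qed.

Lemma perturbation_continuous F e :
  (forall i, continuous (F ^~ i)) ->
  forall i, continuous (fun x => perturbation F e x i).
Proof.
move=> F_cont i.
have pow_cont : continuous (fun x : 'rV[R]_n.+1 => \sum_j x 0 j ^+ m).
  apply: continuous_sum => j; apply: continuous_exprn.
  exact: coord_continuous.
apply: continuous_add; first exact: F_cont.
by apply: continuous_mul => //; exact: cst_continuous.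
Qed.

(* The eigenpairs of the perturbations F + e (sum_j x_j^m) have a cluster point
   as e tends to 0; it minimizes the total residual sum_i |F x i - mu x_i^m|
   over a compact set on which the infimum of the residual is 0. *)
Theorem perron_eigenpair F :
  homogeneous F -> isotone F -> (forall i, continuous (F ^~ i)) ->
  exists mu x, [/\ x != 0, ge0_vec x, forall i, F x i = mu * x 0 i ^+ m
    & forall nu y, subeigenpair F nu y -> nu <= mu].
Proof.
move=> F_hom F_iso F_cont.
have [mu0 [x0 [mu0_ge0 _ Fx0 mu0_max]]] := max_subeigenpair F_hom F_iso F_cont.
pose M := \sum_i perturbation F 1 (const_mx 1) i.
(* The lower end [mu0] makes the limit value at least every nu; the upper end M bounds the values
   for all e <= 1. *)
pose A := simplex `*` `[mu0, M]%classic.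
pose residual (p : 'rV[R]_n.+1 * R) := \sum_i `|F p.1 i - p.2 * p.1 0 i ^+ m|.
have residual_cont : continuous residual.
  apply: continuous_sum => i p.
  apply: (continuous_comp (@residual_continuous F F_cont i p)).
  exact: norm_continuous.
(* At an eigenpair of the perturbation, each of the n+1 residuals of F equals e sum_j x_j^m, at most
   e (n+1) on the simplex. *)
have small (e : R) : 0 < e -> e <= 1 ->
    exists2 p, A p & residual p <= n.+1%:R * (e * n.+1%:R).
  move=> e_gt0 e_le1.
  have Fe_hom := perturbation_homogeneous e F_hom.
  have Fe_iso := perturbation_isotone (ltW e_gt0) F_iso.
  have [mu [x [mu_ge0 sx Fex mu_max]]] :=
    max_subeigenpair Fe_hom Fe_iso (@perturbation_continuous F e F_cont).
  have Fe_strict := perturbation_strictly_isotone e_gt0 F_iso.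
  have Fex_eq := max_subeigenpair_eigen Fe_hom Fe_iso Fe_strict mu_ge0 Fex mu_max.
  have pow_ge0 (y : 'rV[R]_n.+1) : ge0_vec y -> 0 <= \sum_j y 0 j ^+ m.
    by move=> y_ge0; apply: sumr_ge0 => j _; rewrite exprn_ge0.
  exists (x, mu).
    split=> //=; rewrite in_itv /=; apply/andP; split.
      (* The pair of [mu0] and [x0] remains a subeigenpair when F grows. *)
      apply: (mu_max _ x0); case: Fx0 => x0_neq0 x0_ge0 Fx0; split=> // i.
      by apply: le_trans (Fx0 i) _; rewrite lerDl mulr_ge0 ?pow_ge0 // ltW.
    apply: le_trans (subeigenpair_le Fe_hom Fe_iso Fex) _.
    apply: ler_sum => i _; rewrite lerD2l ler_wpM2r //.
    by apply: pow_ge0 => j; rewrite mxE ler01.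
  have pow_le : \sum_j x 0 j ^+ m <= n.+1%:R.
    rewrite -[n.+1 in leRHS]card_ord -sum1_card natr_sum; apply: ler_sum => j _.
    by rewrite exprn_ile1 ?simplex_le1 //; case: sx => + _; apply.
  have -> : n.+1%:R * (e * n.+1%:R) = \sum_(i < n.+1) (e * n.+1%:R).
    by rewrite sumr_const card_ord mulr_natl.
  apply: ler_sum => i _ /=.
  rewrite -Fex_eq /perturbation opprD addNKr normrN ger0_norm.
    by rewrite ler_pM2l.
  by rewrite mulr_ge0 ?(ltW e_gt0) // pow_ge0 //; case: sx.
have A_neq0 : A !=set0 by have [p Ap _] := small 1 ltr01 (lexx 1); exists p.
have A_compact : compact A.
  by apply: compact_setX; [exact: compact_simplex|exact: segment_compact].
have [[x mu] Axmu res_min] :=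
  compact_EVT_min A_neq0 A_compact (continuous_subspaceT residual_cont).
have res0 : residual (x, mu) <= 0.
  rewrite leNgt; apply/negP => r_gt0.
  (* At e = r the bound of [small] is half the minimal residual; the minimum with 1 ensures e <=
     1. *)
  pose r := residual (x, mu) / 2 / n.+1%:R / n.+1%:R.
  have r0 : 0 < r by rewrite !divr_gt0.
  have e_gt0 : 0 < Num.min 1 r by rewrite lt_min ltr01 r0.
  have e_le1 : Num.min 1 r <= 1 by rewrite ge_min lexx.
  have [p Ap] := small _ e_gt0 e_le1.
  apply/negP; rewrite -ltNge; apply: lt_le_trans (res_min p (mem_set Ap)).
  have : n.+1%:R * (Num.min 1 r * n.+1%:R) <= n.+1%:R * (r * n.+1%:R).
    by rewrite ler_pM2l ?ltr0n // ler_pM2r ?ltr0n // ge_min lexx orbT.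
  move/le_lt_trans; apply.
  rewrite mulrC /r !divfK ?pnatr_eq0 //; lra.
have Fx i : F x i = mu * x 0 i ^+ m.
  apply/eqP; rewrite -subr_eq0 -normr_le0; apply: le_trans res0.
  by rewrite /residual (bigD1 i) //= lerDl sumr_ge0.
have [sx /=] := set_mem Axmu; rewrite in_itv /= => /andP[mu0_le _].
exists mu, x; split=> //; [exact: simplex_neq0|by case: sx|].
by move=> nu y /mu0_max /le_trans; apply.
Qed.

End PerronFrobenius.

(** * The polynomial and tropical maps of a tensor *)

Section TensorMaps.
Variables (R : realType) (n d : nat) (E : tensor R n.+1 d).
Hypotheses (d_gt1 : (0 < d.-1)%N) (E_ge0 : nonnegative E).

Definition monomial (J : multi_index n.+1 d) (x : 'rV[R]_n.+1) :=
  \prod_(k < d.-1) x 0 (J k).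

(** The real counterpart of [tensor_map], on row vectors to fit the general theory. *)
Definition sum_map (x : 'rV[R]_n.+1) i :=
  \sum_(J : multi_index n.+1 d) E i J * monomial J x.

Definition max_map (x : 'rV[R]_n.+1) i :=
  \big[Order.max/0]_(J : multi_index n.+1 d) (E i J * monomial J x).

Lemma monomial_homogeneous J c x :
  monomial J (c *: x) = c ^+ d.-1 * monomial J x.
Proof.
rewrite /monomial; under eq_bigr do rewrite mxE.
by rewrite big_split /= prodr_const card_ord.
Qed.

Lemma monomial_ge0 J x : ge0_vec x -> 0 <= monomial J x.
Proof. by move=> x_ge0; apply: prodr_ge0 => k _; exact: x_ge0. Qed.

Lemma monomial_isotone J (x y : 'rV[R]_n.+1) :
  ge0_vec x -> (forall i, x 0 i <= y 0 i) -> monomial J x <= monomial J y.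
Proof. by move=> x_ge0 xy; apply: ler_prod => k _; rewrite x_ge0 xy. Qed.

Lemma monomial_continuous J : continuous (monomial J).
Proof.
apply: continuous_big => [|k _]; first exact: (@mul_continuous R).
exact: coord_continuous.
Qed.

Lemma sum_map_homogeneous : homogeneous d.-1 sum_map.
Proof.
move=> c x i _; rewrite /sum_map mulr_sumr; apply: eq_bigr => J _.
by rewrite monomial_homogeneous mulrCA.
Qed.

Lemma sum_map_isotone : isotone sum_map.
Proof.
move=> x y x_ge0 xy i; apply: ler_sum => J _.
by rewrite ler_wpM2l // monomial_isotone.
Qed.

Lemma sum_map_continuous i : continuous (fun x => sum_map x i).
Proof.
apply: continuous_sum => J; apply: continuous_mul.
  exact: cst_continuous.
exact: monomial_continuous.
Qed.

Lemma max_map_homogeneous : homogeneous d.-1 max_map.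
Proof.
move=> c x i c_ge0; rewrite /max_map.
have cm_ge0 : 0 <= c ^+ d.-1 by rewrite exprn_ge0.
(* Multiplication by c^(d-1) >= 0 commutes with max and fixes the default value 0. *)
rewrite (big_morph (fun t => c ^+ d.-1 * t) (id1 := 0) (op1 := Order.max)).
- by apply: eq_bigr => J _; rewrite monomial_homogeneous mulrCA.
- by move=> s t; rewrite maxr_pMr.
- exact: mulr0.
Qed.

Lemma max_map_isotone : isotone max_map.
Proof.
move=> x y x_ge0 xy i; apply: le_bigmax2 => J _.
by rewrite ler_wpM2l // monomial_isotone.
Qed.

Lemma max_map_continuous i : continuous (fun x => max_map x i).
Proof.
apply: continuous_big => [|J _]; first exact: max_continuous.
apply: continuous_mul; first exact: cst_continuous.
exact: monomial_continuous.
Qed.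

Lemma max_map_le_sum x i : ge0_vec x -> max_map x i <= sum_map x i.
Proof.
move=> x_ge0; have term_ge0 J : 0 <= E i J * monomial J x.
  by rewrite mulr_ge0 // monomial_ge0.
apply: bigmax_le => [|J _]; first exact: sumr_ge0.
by rewrite /sum_map (bigD1 J) //= lerDl sumr_ge0.
Qed.

(** There are (n+1)^(d-1) multi-indices, and each term is at most the maximum. *)
Lemma sum_map_le_max x i :
  sum_map x i <= n.+1%:R ^+ d.-1 * max_map x i.
Proof.
have -> : n.+1%:R ^+ d.-1 * max_map x i =
    \sum_(J : multi_index n.+1 d) max_map x i.
  by rewrite sumr_const card_ffun !card_ord -natrX mulr_natl.
by apply: ler_sum => J _; exact: (le_bigmax _ (fun J => E i J * monomial J x)).
Qed.

Lemma normc_real (r : R) : Normc.normc (r%:C)%C = `|r|.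
Proof. by rewrite /= expr0n addr0 sqrtr_sqr. Qed.

Lemma normcXn (z : R[i]) k : Normc.normc (z ^+ k) = Normc.normc z ^+ k.
Proof.
by elim: k => [|k IH]; rewrite ?Normc.normc1 // !exprS Normc.normcM IH.
Qed.

Lemma normc_ge0 (z : R[i]) : 0 <= Normc.normc z.
Proof. by case: z => a b; exact: sqrtr_ge0. Qed.

(** The witness is the vector of moduli |z_i| of an eigenvector z, by the triangle inequality in
    each coordinate. *)
Lemma eigenvalue_subeigenpair lambda : tensor_eigenvalue E lambda ->
  exists x, subeigenpair d.-1 sum_map (Normc.normc lambda) x.
Proof.
move=> [z z_neq0 /matrixP Ez]; exists (\row_i Normc.normc (z i 0)); split.
- apply: contra z_neq0 => /eqP/rowP z0; apply/eqP/colP => i.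
  by have := z0 i; rewrite !mxE => /Normc.eq0_normc.
- by move=> i; rewrite mxE normc_ge0.
- move=> i; rewrite mxE -normcXn -Normc.normcM.
  have := Ez i 0; rewrite !mxE => <-.
  apply: (@le_trans _ _ (\sum_(J : multi_index n.+1 d)
      Normc.normc ((E i J)%:C%C * \prod_(k < d.-1) z (J k) 0))).
    elim/big_rec2: _ => [|J s t _ st]; first by rewrite Normc.normc0.
    by apply: le_trans (le_normcD _ _) _; rewrite lerD2l.
  apply: ler_sum => J _; rewrite Normc.normcM normc_real ger0_norm //.
  rewrite (big_morph _ (@Normc.normcM R) (@Normc.normc1 R)).
  by rewrite /monomial; under [X in _ <= _ * X]eq_bigr do rewrite mxE.
Qed.

(** The Perron value mu is an eigenvalue, its real eigenvector being read over the complex numbers,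
    and by [eigenvalue_subeigenpair] it bounds all moduli; so the moduli have a greatest element,
    mu. *)
Lemma spectral_radiusP : exists x,
  subeigenpair d.-1 sum_map (spectral_radius E) x /\
  forall nu y, subeigenpair d.-1 sum_map nu y -> nu <= spectral_radius E.
Proof.
have [mu [x [x_neq0 x_ge0 Ex mu_max]]] :=
  perron_eigenpair d_gt1 sum_map_homogeneous sum_map_isotone sum_map_continuous.
have Fx : subeigenpair d.-1 sum_map mu x by split=> // i; rewrite Ex.
(* Since F x >= 0, the value 0 competes in the maximality of mu; the sign makes mu its own
   modulus. *)
have mu_ge0 : 0 <= mu.
  apply: (mu_max _ x); split=> // i; rewrite mul0r.
  exact: (isotone_ge0 d_gt1 sum_map_homogeneous sum_map_isotone).
suff -> : spectral_radius E = mu by exists x.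
apply: maximumE; split=> [|_ [lambda /eigenvalue_subeigenpair[y Ey] <-]].
  exists mu%:C%C; last by rewrite normc_real ger0_norm.
  exists (\col_i (x 0 i)%:C%C).
    apply: contra x_neq0 => /eqP/colP x0; apply/eqP/rowP => i.
    by have := x0 i; rewrite !mxE => /complexI.
  apply/colP => i; rewrite !mxE -rmorphXn -rmorphM -Ex rmorph_sum.
  apply: eq_bigr => J _; rewrite rmorphM rmorph_prod; congr (_ * _).
  by apply: eq_bigr => k _; rewrite mxE.
exact: mu_max Ey.
Qed.

Lemma trop_eigenpair_max_map lambda u : trop_eigenpair E lambda u <->
  [/\ u^T != 0, ge0_vec u^T
    & forall i, max_map u^T i = lambda * u^T 0 i ^+ d.-1].
Proof.
have mapE i : trop_map E u i 0 = max_map u^T i.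
  rewrite mxE; apply: eq_bigr => J _; congr (_ * _).
  by apply: eq_bigr => k _; rewrite mxE.
have u0 : (u^T == 0) = (u == 0) by rewrite -(inj_eq trmx_inj) trmxK trmx0.
rewrite /trop_eigenpair -u0.
by split=> -[u_neq0 u_ge0 Eu]; split=> // i;
  have := u_ge0 i; have := Eu i; rewrite ?mapE ?mxE.
Qed.

(** Every tropical eigenpair is a subeigenpair of [max_map], so the Perron value of [max_map] is the
    largest tropical eigenvalue. *)
Lemma trop_spectral_radiusP : exists x,
  subeigenpair d.-1 max_map (trop_spectral_radius E) x /\
  forall nu y, subeigenpair d.-1 max_map nu y -> nu <= trop_spectral_radius E.
Proof.
have [mu [x [x_neq0 x_ge0 Ex mu_max]]] :=
  perron_eigenpair d_gt1 max_map_homogeneous max_map_isotone max_map_continuous.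
suff -> : trop_spectral_radius E = mu.
  by exists x; split=> //; split=> // i; rewrite Ex.
apply: maximumE; split=> [|lambda [u /trop_eigenpair_max_map[u_neq0 u_ge0 Eu]]].
  by exists x^T; apply/trop_eigenpair_max_map; rewrite trmxK.
by apply: (mu_max _ u^T); split=> // i; rewrite Eu.
Qed.

End TensorMaps.

Theorem corollary25 (R : realType) (n d : nat) (hn : (1 <= n)%N)
    (hd : (3 <= d)%N) (E : tensor R n d)
    (E_ps : partially_symmetric E) (E_ge0 : nonnegative E) :
  trop_spectral_radius E <= spectral_radius E
    <= n%:R ^+ d.-1 * trop_spectral_radius E.
Proof.
case: n hn E E_ps E_ge0 => // n _ E _ E_ge0.
have d_gt1 : (0 < d.-1)%N by case: d hd {E E_ge0} => [|[]].
have [u [[u_neq0 u_ge0 Eu] trop_max]] := trop_spectral_radiusP d_gt1 E_ge0.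
have [x [[x_neq0 x_ge0 Ex] rho_max]] := spectral_radiusP d_gt1 E_ge0.
apply/andP; split.
  (* The tropical maximizer is a subeigenvector of the larger polynomial map. *)
  apply: (rho_max _ u); split=> // i.
  exact: le_trans (Eu i) (max_map_le_sum E_ge0 i u_ge0).
have N_gt0 : 0 < n.+1%:R ^+ d.-1 :> R by rewrite exprn_gt0.
(* Conversely, the polynomial maximizer is a tropical subeigenvector for the spectral radius divided
   by (n+1)^(d-1). *)
rewrite -ler_pdivrMl //; apply: (trop_max _ x); split=> // i.
rewrite -mulrA ler_pdivrMl //.
exact: le_trans (Ex i) (sum_map_le_max E x i).
Qed.
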